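(* Let $\hat\mu=\sum_{i=1}^n a_i\delta_{x_i}$ and $\hat\nu=\sum_{j=1}^m b_j\delta_{y_j}$ be two discrete measures over $\mathbb{R}^d$, where $a_i>0$ for $i=1,\ldots,n$, $b_j>0$ for $j=1,\ldots,m$, $\sum_{i=1}^n a_i=\sum_{j=1}^m b_j=1$, and $x_1,\ldots,x_n,y_1,\ldots,y_m$ are atoms in $\mathbb{R}^d$. Let $C_{i,j}=\frac12\|x_i-y_j\|^2$. Let $P\in\mathbb{R}_+^{n\times m}$ be optimal for the primal linear program $$\min\Big\{\sum_{i,j}C_{i,j}P_{i,j}\ \Big|\ P\in\mathbb{R}_+^{n\times m},\ \sum_{j=1}^m P_{i,j}=a_i,\ \sum_{i=1}^n P_{i,j}=b_j\ \ \forall i,j\Big\}$$ and let $(f,g)\in\mathbb{R}^n\times\mathbb{R}^m$ be optimal for the dual linear program $$\max\Big\{\langle f,a\rangle+\langle g,b\rangle\ \Big|\ f\in\mathbb{R}^n,\ g\in\mathbb{R}^m,\ f_i+g_j\le C_{i,j}\ \ \forall i,j\Big\}.$$ Then $$P_{i,j}>0\implies y_j\in\partial\varphi_g(x_i),$$ where $\varphi_g(x)=\max_{k=1,\ldots,m}\langle x,y_k\rangle+g_k-\frac12\|y_k\|^2$ for $x\in\mathbb{R}^d$. As a consequence, $\varphi_g$ is an optimal Brenier potential for $(\hat\mu,\hat\nu)$, that is, it attains $\min_{\varphi\in\Gamma_0(\mathbb{R}^d)}\int\varphi\,d\hat\mu+\int\varphi^*\,d\hat\nu$, and $$\min_{\varphi\in\Gamma_0(\mathbb{R}^d)}\int\varphi\,d\hat\mu+\int\varphi^*\,d\hat\nu=\min_{g\in\mathbb{R}^m}\int\varphi_g\,d\hat\mu+\int\varphi_g^*\,d\hat\nu,$$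 where for every $g\in\mathbb{R}^m$ the function $\varphi_g$ is defined by the same formula.
   Context: $\|\cdot\|$ is the Euclidean norm. $\Gamma_0(\mathbb{R}^d)$ is the set of proper lower semicontinuous convex functions $\mathbb{R}^d\to\mathbb{R}\cup\{+\infty\}$; $\varphi^*(y)=\sup_{x\in\mathbb{R}^d}\langle x,y\rangle-\varphi(x)$ is the Legendre-Fenchel conjugate; $\partial\varphi$ is the convex subdifferential. *)

(* Defs.v *)
From HB Require Import structures.
From mathcomp Require Import all_boot all_order all_algebra.
From mathcomp Require Import all_classical all_reals all_analysis.

Set Implicit Arguments.
Unset Strict Implicit.
Unset Printing Implicit Defensive.

Import Order.TTheory GRing.Theory Num.Theory.
Import numFieldNormedType.Exports.

Local Open Scope classical_set_scope.
Local Open Scope ring_scope.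

Section optimization.
Context (T : Type) (disp : Order.disp_t) (V : porderType disp).
Implicit Types (A : set T) (F : T -> V).

Definition minimizer A F p := A p /\ forall q, A q -> (F p <= F q)%O.

Definition maximizer A F p := A p /\ forall q, A q -> (F q <= F p)%O.

Definition is_minimum A F (v : V) := exists2 p, minimizer A F p & F p = v.

End optimization.

Section euclidean.
Context (R : realType) (d : nat).

Definition dot (u v : 'rV[R]_d) : R := \sum_(k < d) u 0 k * v 0 k.

(* The library norm `|u| on row vectors is the sup norm; both norms induce the
   library topology on 'rV[R]_d. *)
Definition enorm (u : 'rV[R]_d) : R := Num.sqrt (dot u u).

End euclidean.

Section convex_analysis.
Context (R : realType) (d : nat).
Local Notation E := 'rV[R]_d.
Implicit Type phi : E -> \bar R.
Local Open Scope ereal_scope.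

Definition proper_fun phi :=
  (forall x, -oo < phi x) /\ exists x, phi x < +oo.

(* At t = 0 and t = 1 the products use the convention 0 * +oo = 0. *)
Definition econvex_fun phi := forall (x z : E) (t : R),
  (0 <= t <= 1)%R ->
  phi (t *: x + (1 - t) *: z)%R <= t%:E * phi x + (1 - t)%:E * phi z.

Definition Gamma0 : set (E -> \bar R) :=
  [set phi | [/\ proper_fun phi, lower_semicontinuous phi & econvex_fun phi]].

Definition conjugate phi (y : E) : \bar R :=
  ereal_sup [set (dot x y)%:E - phi x | x in [set: E]].

Definition subdifferential phi (x : E) : set E :=
  [set y | forall z : E, phi x + (dot y (z - x)%R)%:E <= phi z].

End convex_analysis.

Notation borel_rV R d := (g_sigma_algebraType (@open 'rV[R]_d)).

Section discrete_transport.
Context (R : realType) (d : nat).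
Local Notation E := 'rV[R]_d.

(* A bare set function, so that the weights may be an arbitrary real vector; it
   coincides with an msum of mscale of Dirac measures when they are >= 0. *)
Definition discrete_measure n (a : 'rV[R]_n) (x : 'I_n -> E)
    (A : set (borel_rV R d)) : \bar R :=
  (\sum_(i < n) (a 0 i)%:E * \d_(x i : borel_rV R d) A)%E.

Definition brenier_obj (mu nu : set (borel_rV R d) -> \bar R)
    (phi : E -> \bar R) : \bar R :=
  (\int[mu]_x phi x + \int[nu]_y conjugate phi y)%E.

Definition quad_cost n m (x : 'I_n -> E) (y : 'I_m -> E) : 'M[R]_(n, m) :=
  \matrix_(i, j) (2^-1 * enorm (x i - y j) ^+ 2).

(* The value is real as soon as 0 < m. *)
Definition potential m (y : 'I_m -> E) (g : 'rV[R]_m) (x : E) : \bar R :=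
  \big[Order.max/-oo%E]_(k < m)
    (dot x (y k) + g 0 k - 2^-1 * enorm (y k) ^+ 2)%:E.

End discrete_transport.

Section linear_programs.
Context (R : realType) (n m : nat).

Definition transport_plans (a : 'rV[R]_n) (b : 'rV[R]_m) : set 'M[R]_(n, m) :=
  [set P | [/\ forall i j, 0 <= P i j,
               forall i, \sum_(j < m) P i j = a 0 i &
               forall j, \sum_(i < n) P i j = b 0 j]].

Definition transport_cost (C P : 'M[R]_(n, m)) : R :=
  \sum_(i < n) \sum_(j < m) C i j * P i j.

Definition dual_feasible (C : 'M[R]_(n, m)) : set ('rV[R]_n * 'rV[R]_m) :=
  [set fg : 'rV[R]_n * 'rV[R]_m | forall i j, fg.1 0 i + fg.2 0 j <= C i j].

Definition dual_value (a : 'rV[R]_n) (b : 'rV[R]_m)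
    (fg : 'rV[R]_n * 'rV[R]_m) : R := dot fg.1 a + dot fg.2 b.

End linear_programs.

(* Main.v *)
Require Import Defs.
From HB Require Import structures.
From mathcomp Require Import all_boot all_order all_algebra.
From mathcomp Require Import all_classical all_reals all_analysis.
From mathcomp Require Import measurable_realfun.
From mathcomp Require Import ring lra.

Set Implicit Arguments.
Unset Strict Implicit.
Unset Printing Implicit Defensive.

Import Order.TTheory GRing.Theory Num.Theory.
Import numFieldNormedType.Exports.

Local Open Scope classical_set_scope.
Local Open Scope ring_scope.

(** Expanding the square, C_ij = |x_i|^2/2 + |y_j|^2/2 - <x_i, y_j>, so up to
    the two fixed second moments, minimizing the transport cost is maximizing
    the correlation sum_ij P_ij <x_i, y_j>.

    Lower bound. For phi in Gamma_0 and any plan P, the marginal constraints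
    turn J(phi) = sum_i a_i phi(x_i) + sum_j b_j phi^*(y_j) into
    sum_ij P_ij (phi(x_i) + phi^*(y_j)), which is at least the correlation of P
    by the Fenchel-Young inequality ([brenier_obj_ge]).

    Upper bound. If (f, g) is dual feasible, then phi_g(x_i) is at most
    |x_i|^2/2 - f_i, and phi_g^*(y_j) is at most |y_j|^2/2 - g_j for every g.
    Hence J(phi_g) is at most the sum of the second moments minus the dual
    value ([brenier_obj_potential_le]).

    The two bounds meet for optimal P and (f, g) because the linear programs
    have the same value ([optimal_costE]). This strong duality comes from the
    Farkas lemma: if no plan were supported on the pairs where the constraint
    f_i + g_j <= C_ij is tight, the separating vector given by Farkas would be
    a direction along which (f, g) stays feasible and improves
    ([tight_plan]); and a plan supported on tight pairs costs exactly the dual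
    value. So phi_g minimizes J over Gamma_0, and, as every phi_g' lies in
    Gamma_0, also over the potentials phi_g'.

    Equality of the values forces complementary slackness: P_ij > 0 implies
    f_i + g_j = C_ij ([optimal_slackness]). Then the j-th affine piece of phi_g
    reaches the upper bound |x_i|^2/2 - f_i at x_i, so its slope y_j is a
    subgradient there.

    The integrals against the discrete measures are genuine Lebesgue
    integrals for the Borel sigma-algebra; they reduce to finite sums because
    phi and phi^* are lower semicontinuous, hence Borel, and never -oo
    ([integral_discrete]). *)

(** * The Euclidean inner product *)

Section dot_product.
Context (R : realType) (d : nat).
Implicit Types u v w : 'rV[R]_d.

Lemma dotC u v : dot u v = dot v u.
Proof. by apply: eq_bigr => k _; rewrite mulrC. Qed.

Lemma dotDl u v w : dot (u + v) w = dot u w + dot v w.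
Proof. by rewrite -big_split; apply: eq_bigr => k _; rewrite mxE mulrDl. Qed.

Lemma dotZl c u w : dot (c *: u) w = c * dot u w.
Proof. by rewrite big_distrr; apply: eq_bigr => k _; rewrite mxE -mulrA. Qed.

Lemma dotNl u w : dot (- u) w = - dot u w.
Proof. by rewrite -scaleN1r dotZl mulN1r. Qed.

Lemma dotDr u v w : dot w (u + v) = dot w u + dot w v.
Proof. by rewrite dotC dotDl !(dotC w). Qed.

Lemma dotZr c u w : dot w (c *: u) = c * dot w u.
Proof. by rewrite dotC dotZl (dotC w). Qed.

Lemma dotNr u w : dot w (- u) = - dot w u.
Proof. by rewrite dotC dotNl (dotC w). Qed.

Lemma dot0l w : dot 0 w = 0.
Proof. by rewrite -(scale0r 0) dotZl mul0r. Qed.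

Lemma dot0r w : dot w 0 = 0.
Proof. by rewrite dotC dot0l. Qed.

Lemma dot_ge0 u : 0 <= dot u u.
Proof. by apply: sumr_ge0 => k _; rewrite -expr2 sqr_ge0. Qed.

Lemma dot_eq0 u : (dot u u == 0) = (u == 0).
Proof.
apply/eqP/eqP => [u0|->]; last exact: dot0l.
apply/rowP => k; rewrite mxE; apply/eqP; rewrite -sqrf_eq0 expr2.
have /psumr_eq0P/(_ u0 k isT)-> // : forall i : 'I_d, true -> 0 <= u 0 i * u 0 i.
by move=> i _; rewrite -expr2 sqr_ge0.
Qed.

Lemma dot_deltal k u : dot (delta_mx 0 k) u = u 0 k.
Proof.
rewrite /dot (bigD1 k)//= big1 ?addr0 ?mxE ?eqxx ?mul1r// => i /negPf ik.
by rewrite mxE ik andbF mul0r.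
Qed.

Lemma enorm_sqr u : enorm u ^+ 2 = dot u u.
Proof. by rewrite sqr_sqrtr ?dot_ge0. Qed.

Lemma continuous_dotl v : continuous (fun u => dot u v).
Proof.
apply: continuous_big => [|k _ u]; first exact: add_continuous.
apply: (@cvgM R 'rV[R]_d (nbhs u) _ (fun w => w 0 k) (cst (v 0 k))).
  exact: (@coord_continuous R 1 d 0 k).
exact: cvg_cst.
Qed.

End dot_product.

Lemma dot_row_mx (R : realType) (n m : nat) (u : 'rV[R]_n) (v : 'rV[R]_m) w :
  dot (row_mx u v) w = dot u (lsubmx w) + dot v (rsubmx w).
Proof.
rewrite /dot big_split_ord /=; congr (_ + _); apply: eq_bigr => k _.
  by rewrite row_mxEl mxE.
by rewrite row_mxEr mxE.
Qed.

Lemma quad_costE (R : realType) (d n m : nat) (x : 'I_n -> 'rV[R]_d)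
    (y : 'I_m -> 'rV[R]_d) i j :
  quad_cost x y i j =
    2^-1 * dot (x i) (x i) + 2^-1 * dot (y j) (y j) - dot (x i) (y j).
Proof.
rewrite mxE enorm_sqr dotDl !dotDr !dotNl !dotNr (dotC (y j) (x i)); lra.
Qed.

(** * The Farkas lemma *)

(** Bartl's induction on the number of generators. If the vector w separating b
    from the cone of the first generators has dot (v k) w > 0 for the new one,
    project everything along v k onto the orthogonal complement of w. A
    combination for the projected data lifts by adjusting the coefficient of
    v k, and a separating vector lifts by moving it parallel to w until it is
    orthogonal to v k. *)
Lemma farkas (R : realType) (p : nat) (I : eqType) (s : seq I)
    (v : I -> 'rV[R]_p) (b : 'rV[R]_p) : uniq s ->
  (exists2 u : I -> R, forall i, 0 <= u i & b = \sum_(i <- s) u i *: v i) \/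
  (exists2 w, {in s, forall i, dot (v i) w <= 0} & 0 < dot b w).
Proof.
elim: s v b => [v b _|k s IHs v b /= /andP[ks us]].
  have [->|b0] := eqVneq b 0; first by left; exists (cst 0); rewrite ?big_nil.
  by right; exists b; rewrite ?lt_def ?dot_eq0 ?b0 ?dot_ge0.
have [[u u0 ->]|[w vw bw]] := IHs v b us.
  left; exists (fun i => if i == k then 0 else u i); first by move=> i; case: eqP.
  rewrite big_cons eqxx scale0r add0r; apply: eq_big_seq => i si.
  by case: eqP => // ik; rewrite -ik si in ks.
(* Here w separates b from the cone of the generators in s. *)
have [vkw|vkw] := leP (dot (v k) w) 0.
  by right; exists w => // i; rewrite inE => /predU1P[->//|]; exact: vw.
pose r i := dot (v i) w / dot (v k) w.
have [[u u0 bE]|[w' vw' bw']] :=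
    IHs (fun i => v i - r i *: v k) (b - (dot b w / dot (v k) w) *: v k) us.
  (* The coefficient of v k is >= 0 since dot b w > 0, while r i <= 0 on s. *)
  left; exists (fun i => if i == k then
      dot b w / dot (v k) w - \sum_(i <- s) u i * r i else u i).
    move=> i; case: eqP => // _; rewrite subr_ge0.
    apply: (@le_trans _ _ 0); last by rewrite divr_ge0 ?ltW.
    rewrite big_seq sumr_le0// => j sj.
    by rewrite mulr_ge0_le0// pmulr_lle0 ?invr_gt0// vw.
  rewrite big_cons eqxx -[LHS](subrK ((dot b w / dot (v k) w) *: v k)) bE.
  have -> : \sum_(i <- s) (if i == k then dot b w / dot (v k) w -
      \sum_(j <- s) u j * r j else u i) *: v i = \sum_(i <- s) u i *: v i.
    by apply: eq_big_seq => i si; case: eqP => // ik; rewrite -ik si in ks.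
  under eq_bigr do rewrite scalerBr scalerA.
  by rewrite sumrB scalerBl scaler_suml addrC addrCA addrC.
right; exists (w' - (dot (v k) w' / dot (v k) w) *: w).
  move=> i; rewrite inE dotDr dotNr dotZr => /predU1P[->|si].
    by rewrite divfK ?gt_eqF// subrr.
  have := vw' _ si; rewrite dotDl dotNl dotZl /r; congr (_ - _ <= 0); ring.
move: bw'; rewrite !(dotDl, dotDr, dotNl, dotNr, dotZl, dotZr).
by congr (0 < _ - _); ring.
Qed.

(** * Strong duality for the transport problem *)

(** When slacks s k are decreased at rate r k, those that start positive stay
    nonnegative for a short time, since there are finitely many of them. *)
Lemma exists_small_step (R : realType) (I : finType) (s r : I -> R) :
  exists2 e, 0 < e & forall k, 0 < s k -> e * r k <= s k.
Proof.
(* 1 + |r k| rather than |r k| avoids dividing by 0; the default 1 only has to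
   be positive. *)
exists (\big[Order.min/1]_(k | 0 < s k) (s k / (1 + `|r k|))).
  apply: lt_bigmin => // k sk.
  by rewrite divr_gt0// ltr_wpDr.
move=> k sk; set e := \big[_/_]_(_ | _) _.
have e0 : 0 <= e.
  by apply: le_bigmin => // i si; rewrite divr_ge0 ?ltW// ltr_wpDr.
have r1 : 0 < 1 + `|r k| by rewrite ltr_wpDr.
have : e <= s k / (1 + `|r k|) by exact: bigmin_le_cond.
rewrite ler_pdivlMr//; apply: le_trans; rewrite ler_wpM2l//.
by have := ler_norm (r k); lra.
Qed.

Section kantorovich_duality.
Context (R : realType) (n m : nat).
Variables (a : 'rV[R]_n) (b : 'rV[R]_m) (C : 'M[R]_(n, m)).
Implicit Types (P : 'M[R]_(n, m)) (f : 'rV[R]_n) (g : 'rV[R]_m).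

(** Integrating a function h + k of separated variables against a coupling only
    sees the marginals. *)
Lemma plan_sum P (h : 'I_n -> R) (k : 'I_m -> R) : transport_plans a b P ->
  \sum_i \sum_j P i j * (h i + k j) =
    \sum_i a 0 i * h i + \sum_j b 0 j * k j.
Proof.
case=> _ Pa Pb.
under eq_bigr do under eq_bigr do rewrite mulrDr.
under eq_bigr do rewrite big_split /=.
rewrite big_split /= [X in _ + X]exchange_big /=.
by congr (_ + _); apply: eq_bigr => k' _; rewrite -mulr_suml ?Pa ?Pb.
Qed.

Lemma plan_slack P f g : transport_plans a b P ->
  \sum_i \sum_j (C i j - f 0 i - g 0 j) * P i j =
    transport_cost C P - dual_value a b (f, g).
Proof.
move=> tP; rewrite /dual_value /dot /=.
under [X in _ - (X + _)]eq_bigr do rewrite mulrC.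
under [X in _ - (_ + X)]eq_bigr do rewrite mulrC.
rewrite -(plan_sum (f 0) (g 0) tP) /transport_cost -sumrB.
by apply: eq_bigr => i _; rewrite -sumrB; apply: eq_bigr => j _; ring.
Qed.

(** The heart of strong duality: apply the Farkas lemma to the vectors
    (e_i, e_j), one for each tight pair (i, j), and the target (a, b). A conic
    combination is a plan supported on tight pairs. A separating vector (f', g')
    satisfies f'_i + g'_j <= 0 on tight pairs, so that (f, g) + e (f', g') is
    feasible for small e > 0, with a larger dual value. *)
Lemma tight_plan f g : maximizer (dual_feasible C) (dual_value a b) (f, g) ->
  exists2 Q, transport_plans a b Q &
    forall i j, Q i j != 0 -> f 0 i + g 0 j = C i j.
Proof.
case=> fg_feas fg_max.
pose T (k : 'I_n * 'I_m) := f 0 k.1 + g 0 k.2 == C k.1 k.2.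
(* The pairs that are not tight get the zero generator, which lets the index
   range over all pairs. *)
pose v (k : 'I_n * 'I_m) : 'rV[R]_(n + m) :=
  if T k then row_mx (delta_mx 0 k.1) (delta_mx 0 k.2) else 0.
have [[u u0 abE]|[w vw abw]] :=
    farkas v (row_mx a b) (enum_uniq {: 'I_n * 'I_m}).
  exists (\matrix_(i, j) (if T (i, j) then u (i, j) else 0)); last first.
    by move=> i j; rewrite mxE; case: ifP => [/eqP//|]; rewrite eqxx.
  move: abE; rewrite big_enum /= => abE.
  (* Testing the identity abE against basis vectors yields the marginals. *)
  have uvE w : dot (row_mx a b) w =
      \sum_i \sum_j (if T (i, j) then u (i, j) else 0) *
        (lsubmx w 0 i + rsubmx w 0 j).
    rewrite abE pair_big /=; pose F u := dot u w.
    rewrite -/(F _) (big_morph F (id1 := 0) (op1 := +%R)); last 2 first.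
      by move=> ? ?; exact: dotDl.
      exact: dot0l.
    apply: eq_bigr => -[i j] _; rewrite /F dotZl /v /=.
    case: ifP => _; last by rewrite dot0l mulr0 mul0r.
    by rewrite dot_row_mx !dot_deltal.
  split => [i j|i|j].
  - by rewrite mxE; case: ifP.
  - have := uvE (row_mx (delta_mx 0 i) 0).
    rewrite dot_row_mx row_mxKl row_mxKr dotC dot_deltal dot0r addr0 => ->.
    rewrite (bigD1 i)//= [X in _ + X]big1 ?addr0 => [|k /negPf ki]; last first.
      by rewrite big1// => l _; rewrite !mxE ki addr0 mulr0.
    by apply: eq_bigr => j _; rewrite !mxE !eqxx addr0 mulr1.
  - have := uvE (row_mx 0 (delta_mx 0 j)).
    rewrite dot_row_mx row_mxKl row_mxKr [X in _ + X]dotC dot_deltal dot0r add0r => ->.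
    apply: eq_bigr => i _; rewrite (bigD1 j)//= [X in _ + X]big1 ?addr0.
      by rewrite !mxE !eqxx add0r mulr1.
    by move=> l /negPf lj; rewrite !mxE lj add0r mulr0.
pose f' := lsubmx w; pose g' := rsubmx w.
have [e e0 le_e] := exists_small_step
  (fun k : 'I_n * 'I_m => C k.1 k.2 - f 0 k.1 - g 0 k.2)
  (fun k => f' 0 k.1 + g' 0 k.2).
have feas : dual_feasible C (f + e *: f', g + e *: g').
  move=> i j; rewrite /= !mxE -/(f' 0 i) -/(g' 0 j).
  have := fg_feas i j; rewrite /= le_eqVlt => /orP[tij|].
    have := vw (i, j); rewrite mem_enum => /(_ isT).
    rewrite /v /T tij dot_row_mx !dot_deltal -/f' -/g' /= => fg'.
    have := eqP tij; have : e * (f' 0 i + g' 0 j) <= 0.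
      by rewrite pmulr_rle0.
    by rewrite !mxE mulrDr; lra.
  move=> lt_ij; have := le_e (i, j); rewrite /= subr_gt0 ltrBrDl => /(_ _).
  by rewrite !mxE mulrDr; lra.
have := fg_max _ feas; rewrite /dual_value /= !dotDl !dotZl.
have := mulr_gt0 e0 abw.
by rewrite dot_row_mx mulrDr -/f' -/g' (dotC a) (dotC b); lra.
Qed.

(** Weak duality bounds the cost of P from below. From above, P is no more
    expensive than a plan supported on tight pairs, which costs the dual
    value. *)
Lemma optimal_costE P f g :
  minimizer (transport_plans a b) (transport_cost C) P ->
  maximizer (dual_feasible C) (dual_value a b) (f, g) ->
  transport_cost C P = dual_value a b (f, g).
Proof.
move=> [tP P_min] fg_max; have [fg_feas _] := fg_max.
have [Q tQ Qtight] := tight_plan fg_max.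
apply/eqP; rewrite eq_le -[X in _ && X]subr_ge0 -plan_slack// andbC.
rewrite sumr_ge0/= => [|i _]; last first.
  apply: sumr_ge0 => j _; rewrite mulr_ge0//; last by case: tP.
  by have := fg_feas i j; rewrite /=; lra.
apply: le_trans (P_min _ tQ) _; rewrite -subr_le0 -plan_slack//.
apply: sumr_le0 => i _; apply: sumr_le0 => j _.
have [->|/Qtight <-] := eqVneq (Q i j) 0; first by rewrite mulr0.
by rewrite -addrA -opprD subrr mul0r.
Qed.

(** The difference of the two values is a sum of nonnegative terms, one for
    each pair, and it vanishes. *)
Lemma optimal_slackness P f g :
  minimizer (transport_plans a b) (transport_cost C) P ->
  maximizer (dual_feasible C) (dual_value a b) (f, g) ->
  forall i j, 0 < P i j -> f 0 i + g 0 j = C i j.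
Proof.
move=> P_opt fg_opt i j Pij; have [tP _] := P_opt; have [fg_feas _] := fg_opt.
have slack_ge0 k l : 0 <= (C k l - f 0 k - g 0 l) * P k l.
  rewrite mulr_ge0//; last by case: tP.
  by have := fg_feas k l; rewrite /=; lra.
have total0 := plan_slack f g tP.
rewrite (optimal_costE P_opt fg_opt) subrr in total0.
have row0 := psumr_eq0P (fun k _ => sumr_ge0 _ (fun l _ => slack_ge0 k l)) total0.
have := psumr_eq0P (fun l _ => slack_ge0 i l) (row0 i isT) (i := j) isT.
by move/eqP; rewrite mulf_eq0 (gt_eqF Pij) orbF => /eqP; lra.
Qed.

End kantorovich_duality.

(** * Integration against discrete measures *)

Section discrete_integral.
Context (R : realType) (d : nat).
Local Notation E := 'rV[R]_d.
Local Open Scope ereal_scope.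

Lemma lower_semicontinuous_borel (phi : E -> \bar R) : lower_semicontinuous phi ->
  measurable_fun [set: borel_rV R d] (phi : borel_rV R d -> \bar R).
Proof.
move=> /lower_semicontinuousP sci.
apply: (measurability _ (ErealGenOInfty.measurableE R)).
move=> /= _ [_ [r ->]] <-; apply: measurableI => //.
by rewrite preimage_itvoy; apply: sub_sigma_algebra; exact: sci.
Qed.

Section weighted_diracs.
Variables (n : nat) (a : 'rV[R]_n) (x : 'I_n -> E).
Hypothesis a_ge0 : forall i, (0 <= a 0 i)%R.

(** The discrete set function is a measure, as a sum of nonnegatively scaled
    Dirac measures; being given only as a set function, it has to be identified
    with such a sum before the integration theorems apply. *)
Lemma discrete_measureE :
  exists2 mu : {measure set (borel_rV R d) -> \bar R},
    discrete_measure a x = mu &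
    forall phi : borel_rV R d -> \bar R,
      measurable_fun setT phi -> (forall z, 0 <= phi z) ->
      \int[mu]_z phi z = \sum_(i < n) (a 0 i)%:E * phi (x i).
Proof.
(* [msum] takes a family of measures indexed by nat; its values outside 'I_n do
   not enter the sum. *)
pose w k : {nonneg R} :=
  if insub k is Some i then NngNum (a_ge0 i) else @NngNum R 0 (lexx _).
pose pt k : borel_rV R d := if insub k is Some i then x i else 0%R.
pose mk k : {measure set (borel_rV R d) -> \bar R} := mscale (w k) (\d_(pt k)).
exists (msum mk n) => [|phi mphi phi0].
  apply/funext => A; rewrite /discrete_measure /msum; apply: eq_bigr => i _.
  by rewrite /mk/= /mscale /w /pt valK.
rewrite ge0_integral_measure_sum//; apply: eq_bigr => i _.
rewrite ge0_integral_mscale// integral_dirac// diracT mul1e.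
by rewrite /w /pt valK.
Qed.

(** The value +oo is allowed for phi; excluding -oo makes the integral of the
    negative part finite, so that the two parts recombine. *)
Lemma integral_discrete (phi : borel_rV R d -> \bar R) :
  measurable_fun setT phi -> (forall z, -oo < phi z) ->
  \int[discrete_measure a x]_z phi z = \sum_(i < n) (a 0 i)%:E * phi (x i).
Proof.
move=> mphi phiNy; have [mu -> ge0_int] := discrete_measureE.
rewrite integralE.
rewrite (ge0_int _ (measurable_funepos mphi) (funepos_ge0 phi)).
rewrite (ge0_int _ (measurable_funeneg mphi) (funeneg_ge0 phi)).
have fin_neg z : phi^\- z \is a fin_num.
  rewrite funenegE; have := phiNy z.
  case: (phi z) => [r| |] // _; last by rewrite /= (max_idPr (leNye _)).
  by rewrite /Order.max; case: ifP.
rewrite -fin_num_sumeN => [|i _]; last by rewrite fin_numM.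
rewrite -big_split /=; apply: eq_bigr => i _.
rewrite -muleN -muleDr//; first by rewrite [in RHS](funeposneg phi).
by rewrite fin_num_adde_defl ?fin_numN.
Qed.

End weighted_diracs.
End discrete_integral.

(** * Conjugates and polyhedral potentials *)

Section gamma0.
Context (R : realType) (d : nat).
Local Notation E := 'rV[R]_d.
Implicit Type phi : E -> \bar R.
Local Open Scope ereal_scope.

(** A supremum of continuous functions is lower semicontinuous. This pointwise
    form serves both for the conjugate, a supremum of affine functions over a
    set, and for the potential, a finite maximum. *)
Lemma lower_semicontinuous_minorants phi :
  (forall z (r : R), r%:E < phi z -> exists2 h : E -> R,
    continuous h & (r < h z)%R /\ forall w, (h w)%:E <= phi w) ->
  lower_semicontinuous phi.
Proof.
move=> minor z r /minor[h ch [rh hphi]].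
exists [set w | (r < h w)%R].
  exact: (cvgr_gt (h z) (ch z)).
by move=> w /= rw; apply: lt_le_trans (hphi w); rewrite lte_fin.
Qed.

Lemma continuous_affine (v : E) (c : R) :
  continuous (fun z : E => (dot z v + c)%R).
Proof.
move=> z; apply: (@cvgD R _ E (nbhs z) _ (fun w => dot w v) (cst c)).
  exact: continuous_dotl.
exact: cvg_cst.
Qed.

Lemma conjugateNy phi y : proper_fun phi -> -oo < conjugate phi y.
Proof.
move=> [phiNy [z phizy]].
have fz : phi z \is a fin_num by rewrite fin_real// phiNy phizy.
apply: (@lt_le_trans _ _ ((dot z y)%:E - phi z)); last first.
  by apply: ereal_sup_ubound; exists z.
by rewrite -(fineK fz) -EFinB ltNyr.
Qed.

Lemma lower_semicontinuous_conjugate phi : proper_fun phi ->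
  lower_semicontinuous (conjugate phi).
Proof.
move=> [phiNy _]; apply: lower_semicontinuous_minorants => y r.
move=> /ereal_sup_gt[_ [z _ <-]]; have := phiNy z.
case phiz : (phi z) => [c| |]// _; rewrite ?addeNy//.
rewrite -EFinB lte_fin => rlt; exists (fun w => (dot w z - c)%R).
  exact: continuous_affine.
split; first by rewrite dotC.
by move=> w; apply: ereal_sup_ubound; exists z => //; rewrite phiz -EFinB dotC.
Qed.

(** Properness keeps the sum away from the indeterminate +oo + -oo. *)
Lemma fenchel_young phi z y : proper_fun phi ->
  (dot z y)%:E <= phi z + conjugate phi y.
Proof.
move=> pphi; have := conjugateNy y pphi; have [phiNy _] := pphi.
have := phiNy z; have : (dot z y)%:E - phi z <= conjugate phi y.
  by apply: ereal_sup_ubound; exists z.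
case: (phi z) => [c| |]// h _ cNy; last by rewrite addye ?gt_eqF// leey.
by rewrite addeC -leeBlDr.
Qed.

Section potential.
Variables (m : nat) (y : 'I_m -> E) (g : 'rV[R]_m).

Lemma potential_ge k z :
  (dot z (y k) + g 0 k - 2^-1 * enorm (y k) ^+ 2)%:E <= potential y g z.
Proof.
pose piece j := (dot z (y j) + g 0 j - 2^-1 * enorm (y j) ^+ 2)%:E.
exact: (le_bigmax _ piece).
Qed.

Lemma potential_le z c :
  (forall k, (dot z (y k) + g 0 k - 2^-1 * enorm (y k) ^+ 2)%:E <= c) ->
  potential y g z <= c.
Proof. by move=> h; apply: bigmax_le => //; exact: leNye. Qed.

(** The potential dominates its k-th affine piece, and the conjugate of an
    affine function of slope y k takes at y k the value opposite to its
    constant term. *)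
Lemma conjugate_potential_le k :
  conjugate (potential y g) (y k) <= (2^-1 * dot (y k) (y k) - g 0 k)%:E.
Proof.
apply: ge_ereal_sup => _ [z _ <-]; have := potential_ge k z.
rewrite -enorm_sqr; case: (potential y g z) => [r| |]//=.
  by rewrite -EFinB !lee_fin; lra.
by rewrite addeNy leNye.
Qed.

Lemma potential_lty z : potential y g z < +oo.
Proof. by apply: bigmax_lt => //= k _; rewrite ltry. Qed.

Lemma Gamma0_potential : (0 < m)%N -> Gamma0 (potential y g).
Proof.
move=> m0; split.
- split=> [z|]; last by exists 0%R; exact: potential_lty.
  by apply: lt_le_trans (potential_ge (Ordinal m0) z); rewrite ltNyr.
- apply: lower_semicontinuous_minorants => z r /bigmax_gtP[//|[k _ rk]].
  exists (fun w => (dot w (y k) + (g 0 k - 2^-1 * enorm (y k) ^+ 2))%R).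
    exact: continuous_affine.
  split; first by rewrite addrA -lte_fin.
  by move=> w; rewrite addrA potential_ge.
- move=> u v t /andP[t0 t1]; apply: potential_le => k.
  set s := (1 - t)%R; have s0 : (0 <= s)%R by rewrite subr_ge0.
  have := leeD (@lee_wpmul2l _ t%:E t0 _ _ (potential_ge k u))
               (@lee_wpmul2l _ s%:E s0 _ _ (potential_ge k v)).
  apply: le_trans; rewrite -!EFinM -EFinD lee_fin dotDl !dotZl /s.
  by rewrite le_eqVlt; apply/orP; left; apply/eqP; ring.
Qed.

End potential.
End gamma0.

(** * Bounds on the Brenier objective *)

Section brenier_objective.
Context (R : realType) (d n m : nat).
Variables (a : 'rV[R]_n) (b : 'rV[R]_m).
Variables (x : 'I_n -> 'rV[R]_d) (y : 'I_m -> 'rV[R]_d).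
Hypotheses (a_ge0 : forall i, 0 <= a 0 i) (b_ge0 : forall j, 0 <= b 0 j).
Local Notation J := (brenier_obj (discrete_measure a x) (discrete_measure b y)).

Lemma brenier_objE phi : Gamma0 phi ->
  J phi = (\sum_i (a 0 i)%:E * phi (x i) +
           \sum_j (b 0 j)%:E * conjugate phi (y j))%E.
Proof.
move=> [pphi lphi _]; rewrite /brenier_obj.
rewrite (integral_discrete _ a_ge0 (lower_semicontinuous_borel lphi)); last first.
  by have [] := pphi.
rewrite (integral_discrete _ b_ge0 (lower_semicontinuous_borel
  (lower_semicontinuous_conjugate pphi)))// => z.
exact: conjugateNy.
Qed.

(** Splitting the weights a_i and b_j along the rows and columns of P pairs each
    phi(x_i) with each phi^*(y_j), where the Fenchel-Young inequality applies. *)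
Lemma brenier_obj_ge P phi : transport_plans a b P -> Gamma0 phi ->
  ((\sum_i \sum_j P i j * dot (x i) (y j))%:E <= J phi)%E.
Proof.
move=> [P0 Pa Pb] Gphi; have [pphi _ _] := Gphi.
have EP0 i j : (0 <= (P i j)%:E)%E by rewrite lee_fin.
have -> : J phi = (\sum_i \sum_j (P i j)%:E * (phi (x i) + conjugate phi (y j)))%E.
  have phiNy z : (-oo < phi z)%E by case: pphi.
  rewrite brenier_objE//.
  under [RHS]eq_bigr do under eq_bigr do
    rewrite muleDr// ?ltninfty_adde_def ?inE ?conjugateNy//.
  under [RHS]eq_bigr do rewrite big_split /=.
  rewrite [RHS]big_split /= [X in _ = (_ + X)%E]exchange_big /=.
  congr (_ + _)%E; apply: eq_bigr => k _; rewrite -ge0_sume_distrl// sumEFin.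
    by rewrite Pa.
  by rewrite Pb.
rewrite -sumEFin; apply: lee_sum => i _; rewrite -sumEFin; apply: lee_sum => j _.
by rewrite EFinM lee_wpmul2l// fenchel_young.
Qed.

(** Dual feasibility says exactly that each affine piece of the potential is
    below |x_i|^2/2 - f_i at x_i. *)
Lemma potential_le_dual f g i : dual_feasible (quad_cost x y) (f, g) ->
  (potential y g (x i) <= (2^-1 * dot (x i) (x i) - f 0 i)%:E)%E.
Proof.
move=> feas; apply: potential_le => k; rewrite lee_fin enorm_sqr.
by have := feas i k; rewrite /= quad_costE; lra.
Qed.

Lemma brenier_obj_potential_le f g : (0 < m)%N ->
  dual_feasible (quad_cost x y) (f, g) ->
  (J (potential y g) <= (\sum_i a 0 i * (2^-1 * dot (x i) (x i)) +
     \sum_j b 0 j * (2^-1 * dot (y j) (y j)) - dual_value a b (f, g))%:E)%E.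
Proof.
move=> m0 feas; rewrite brenier_objE; last exact: Gamma0_potential.
rewrite /dual_value opprD addrACA EFinD; apply: leeD.
  rewrite /dot -sumrB -sumEFin; apply: lee_sum => i _.
  rewrite (mulrC (f 0 i)) -mulrBr EFinM lee_wpmul2l ?lee_fin//.
  exact: potential_le_dual.
rewrite /dot -sumrB -sumEFin; apply: lee_sum => j _.
rewrite (mulrC (g 0 j)) -mulrBr EFinM lee_wpmul2l ?lee_fin//.
exact: conjugate_potential_le.
Qed.

Lemma plan_dotE P : transport_plans a b P ->
  \sum_i \sum_j P i j * dot (x i) (y j) =
    \sum_i a 0 i * (2^-1 * dot (x i) (x i)) +
    \sum_j b 0 j * (2^-1 * dot (y j) (y j)) - transport_cost (quad_cost x y) P.
Proof.
move=> tP; rewrite -(plan_sum _ _ tP) /transport_cost -sumrB.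
apply: eq_bigr => i _; rewrite -sumrB; apply: eq_bigr => j _.
by rewrite quad_costE; ring.
Qed.

End brenier_objective.

(** * Optimality of the potential *)

Theorem lemma3p2 (R : realType) (d n m : nat)
    (a : 'rV[R]_n) (b : 'rV[R]_m)
    (x : 'I_n -> 'rV[R]_d) (y : 'I_m -> 'rV[R]_d)
    (a_gt0 : forall i, 0 < a 0 i) (b_gt0 : forall j, 0 < b 0 j)
    (a_sum1 : \sum_(i < n) a 0 i = 1) (b_sum1 : \sum_(j < m) b 0 j = 1)
    (P : 'M[R]_(n, m)) (f : 'rV[R]_n) (g : 'rV[R]_m)
    (P_opt : minimizer (transport_plans a b)
       (transport_cost (quad_cost x y)) P)
    (fg_opt : maximizer (dual_feasible (quad_cost x y))
       (dual_value a b) (f, g)) :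
  let J := brenier_obj (discrete_measure a x) (discrete_measure b y) in
  [/\ forall i j, 0 < P i j -> subdifferential (potential y g) (x i) (y j),
      minimizer (@Gamma0 R d) J (potential y g) &
      exists v : \bar R,
        is_minimum (@Gamma0 R d) J v /\
        is_minimum [set: 'rV[R]_m] (fun g' => J (potential y g')) v].
Proof.
move=> J.
have m0 : (0 < m)%N.
  rewrite lt0n; apply/eqP => m0; move: b_sum1; rewrite big1 => [/eqP|[k km] _].
    by rewrite eq_sym oner_eq0.
  by exfalso; rewrite m0 in km.
have a_ge0 i : 0 <= a 0 i by exact: ltW.
have b_ge0 j : 0 <= b 0 j by exact: ltW.
have [tP _] := P_opt; have [fg_feas _] := fg_opt.
have Jmin : minimizer (@Gamma0 R d) J (potential y g).
  split=> [|phi Gphi]; first exact: Gamma0_potential.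
  apply: le_trans (brenier_obj_ge x y a_ge0 b_ge0 tP Gphi).
  rewrite (plan_dotE x y tP) (optimal_costE P_opt fg_opt).
  exact: brenier_obj_potential_le.
split => [i j Pij z|//|].
  (* The middle term is the j-th affine piece of the potential at z, since by
     slackness that piece takes the value |x_i|^2/2 - f_i at x_i. *)
  have fgC := optimal_slackness P_opt fg_opt Pij.
  apply: le_trans (potential_ge y g j z).
  apply: (@le_trans _ _ ((2^-1 * dot (x i) (x i) - f 0 i)%:E +
                         (dot (y j) (z - x i))%:E)%E).
    by rewrite leeD2r// potential_le_dual.
  rewrite -EFinD lee_fin enorm_sqr dotDr dotNr (dotC (y j) z) (dotC (y j) (x i)).
  by move: fgC; rewrite quad_costE; lra.
exists (J (potential y g)); split; first by exists (potential y g).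
exists g => //; split => // g' _; apply: Jmin.2.
exact: Gamma0_potential.
Qed.
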